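(* Let $f \in \mathcal{P}$, and let $\rho_1 < \rho_2 < \cdots < \rho_m$ be the points of the open interval $(0,1)$ at which $f$ is not differentiable ($m \ge 0$); set $\rho_0 := 0$ and $\rho_{m+1} := 1$. Then there is a constant $C_f > 0$, depending only on $f$, such that for every positive integer $N$ with $N\rho_i \in \mathbb{Z}$ for all $i \in \{0,1,\ldots,m+1\}$, \[ \left| \log \left( \#\operatorname{RP}(\lambda(f,N)) \right) - N \log N - B_f \cdot N - \frac{1}{2} \log N \right| \le C_f, \] where \[ B_f = \int_0^1 \log(f(x)+x-1) \, dx := \lim_{\varepsilon \searrow 0} \int_{\varepsilon}^1 \log(f(x)+x-1)\,dx . \]
   Context: The class $\mathcal{P}$ consists of all functions $f:[0,1]\to[0,1]$ such that: $f$ is weakly decreasing; $f$ is piecewise linear with finitely many non-differentiable points; all non-differentiable points of $f$ are rational numbers in $[0,1]$; there is $\varepsilon>0$ with $f(x)=1$ for all $0\le x<\varepsilon$; $f(1)>0$; and for every $a\in(0,1)$, $\lim_{x\searrow a} f(x) > 1-a$. For a positive integer $N$, $\lambda(f,N)$ is the partition with exactly $N$ parts whose $i$-th part is $\lceil N f(i/N)\rceil$. For a partition $\lambda=(\lambda_1\ge\cdots\ge\lambda_n)$ with exactly $n$ parts, $\operatorname{RP}(\lambda)$ (rook placements of shape $\lambda$) is the set of $n\times n$ permutation matrices $\pi=(\pi_{ij})$ such that $\pi_{ij}=0$ whenever $j>\lambda_{n+1-i}$. *)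

(* Defs.v *)
From HB Require Import structures.
From mathcomp Require Import all_boot all_order all_algebra.
From mathcomp Require Import all_classical all_reals all_analysis.
Set Implicit Arguments.
Unset Strict Implicit.
Unset Printing Implicit Defensive.
Import Order.TTheory GRing.Theory Num.Theory.
Import numFieldNormedType.Exports.
Local Open Scope classical_set_scope.
Local Open Scope ring_scope.

(* A function [0, 1] -> [0, 1] is represented by some f : R -> R; nothing below
   depends on the values of f outside [0, 1]. *)

(* The endpoints are left out: 0 and 1 are rational, so counting them as points
   of non-differentiability or not does not affect the class P. *)
Definition nondiff_points (R : realType) (f : R -> R) : set R :=
  [set x | 0 < x < 1 /\ ~ derivable f x 1].

(* f is affine on each open interval of a finite subdivision of [0, 1]. Jumps
   are allowed, and the values at the subdivision points are not constrained. *)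
Definition piecewise_linear (R : realType) (f : R -> R) : Prop :=
  exists t : seq R,
    [/\ path <%R 0 t, last 0 t = 1 &
        forall i, (i < size t)%N ->
          exists a b : R, forall x, (0 :: t)`_i < x < t`_i -> f x = a * x + b].

Record classP (R : realType) (f : R -> R) : Prop := ClassP {
  classP_range : forall x, 0 <= x <= 1 -> 0 <= f x <= 1;
  classP_decreasing : forall x y, 0 <= x -> x <= y -> y <= 1 -> f y <= f x;
  classP_piecewise_linear : piecewise_linear f;
  classP_finite_nondiff : finite_set (nondiff_points f);
  classP_rational_nondiff :
    forall x, nondiff_points f x -> exists q : rat, x = ratr q;
  classP_near0 : exists2 e : R, 0 < e & forall x, 0 <= x < e -> f x = 1;
  classP_at1 : 0 < f 1;
  classP_right_limit : forall a : R, 0 < a < 1 ->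
    exists2 l : R, f x @[x --> a^'+] --> l & 1 - a < l
}.

(* Tuples are 0-indexed, so the entry i is the part of index i.+1. The ceiling is
   nonnegative when f >= 0 on [0, 1], so that the absolute value only converts
   it to nat. *)
Definition lambda (R : realType) (f : R -> R) (N : nat) : N.-tuple nat :=
  [tuple `|Num.ceil (N%:R * f (i.+1%:R / N%:R))|%N | i < N].

(* Permutation matrices are taken with entries in bool, with 0 = false and
   1 = true. With 0-based indices, the row i is constrained by the part
   tnth la (rev_ord i), and the column of index j.+1 is the column j. *)
Definition RP (n : nat) (la : n.-tuple nat) : {set 'M[bool]_n} :=
  [set p : 'M[bool]_n | is_perm_mx p &&
    [forall i : 'I_n, forall j : 'I_n,
       (tnth la (rev_ord i) < j.+1)%N ==> (p i j == 0)]]%SET.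

Definition Bconst (R : realType) (f : R -> R) : R :=
  lim ((\int[lebesgue_measure]_(x in `[e, 1]) ln (f x + x - 1))%R
         @[e --> 0^'+]).

(* Main.v *)
(** The shape is weakly decreasing, so placing the rooks from the shortest row to
    the longest gives
    [#RP(lambda(f,N)) = prod_(k=1..N) (ceil (N f(k/N)) + k - N)].
    With [g x = f x + x - 1], the k-th factor is [N g(k/N)] up to an error in
    [0, 1), and it is exactly [k] near [0], where [f = 1]. Factoring [k] out of
    it leaves [N!], handled by Stirling's formula, and the sum over [k] of
    [h(k/N)], where [h x = ln (g x) - ln x]. Since [f] is monotone and [g] is
    bounded away from [0] outside any neighbourhood of [0], [h] has bounded
    variation, hence that sum is [N] times the integral of [h] up to [O(1)].
    Finally [B_f] is the integral of [h] plus that of [ln], which is [-1]. *)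

Require Import Defs.
From HB Require Import structures.
From mathcomp Require Import all_boot all_order all_algebra all_fingroup.
From mathcomp Require Import all_classical all_reals all_analysis.
From mathcomp Require Import measurable_realfun ring lra.
Import Order.TTheory GRing.Theory Num.Theory.
Import numFieldNormedType.Exports.
Local Open Scope classical_set_scope.
Local Open Scope ring_scope.
Set Implicit Arguments.
Unset Strict Implicit.
Unset Printing Implicit Defensive.

(** * Counting rook placements *)

Section rook_words.
Local Open Scope nat_scope.

(** Letter [k] of a word is the column of the rook in the row of length [la_k]. The tail is chosen
    first, so a weakly decreasing [la] is filled starting from its shortest row. *)
Fixpoint rook_words (la : seq nat) : seq (seq nat) :=
  if la is l :: la' then
    [seq x :: t | t <- rook_words la', x <- [seq x <- iota 0 l | x \notin t]]
  else [:: [::]].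

Lemma mem_rook_words la t :
  (t \in rook_words la) = uniq t && all2 ltn t la.
Proof.
elim: la t => [|l la IH] [|x t] //=; first by rewrite andbF.
  by apply/idP => /allpairsPdep[s [y [_ _]]].
apply/allpairsPdep/andP => [[s [y []]]|[/andP[xt ut] /andP[xl a]]].
  rewrite IH mem_filter mem_iota /= add0n => /andP[us a] /andP[ys yl] [-> ->].
  by rewrite ys us yl a.
by exists t, x; rewrite IH ut a mem_filter xt mem_iota.
Qed.

Lemma uniq_rook_words la : uniq (rook_words la).
Proof.
elim: la => //= l la IH; apply: allpairs_uniq_dep => //.
  by move=> t _; rewrite filter_uniq ?iota_uniq.
by move=> [t x] [t' x'] /= _ _ [-> ->].
Qed.

(** The columns used by the later, shorter rows all lie within the current row, so they exclude the
    same number of its columns whatever the tail is. A row shorter than the number of rows after it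
    admits no tail at all, so truncated subtraction does no harm. *)
Lemma size_rook_words la : sorted geq la ->
  size (rook_words la) = \prod_(k < size la) (nth 0 la k - (size la - k.+1)).
Proof.
elim: la => [|l la IH] s_la; first by rewrite big_ord0.
rewrite [size (_ :: _)]/= big_ord_recl /= subn1 /= -IH ?(path_sorted s_la) //.
rewrite size_allpairs_dep.
have le_l : {in la, forall y, y <= l}.
  move=> y; move: s_la; rewrite /= (path_sortedE (leT := geq)).
    by move=> /andP[/allP h _]; exact: h.
  by move=> ? ? ? /= h1 h2; exact: leq_trans h2 h1.
rewrite (eq_in_map _ (fun=> l - size la) _).1.
  by rewrite sumnE big_map big_const_seq count_predT iter_addn_0.
move=> t /=; rewrite mem_rook_words => /andP[ut at_].
have st : size t = size la by move: at_; rewrite all2E => /andP[/eqP].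
have sub : {subset t <= iota 0 l}.
  move=> x /(nthP 0)[i it <-]; rewrite mem_iota /= add0n.
  apply: leq_trans (le_l (nth 0 la i) _); last by rewrite mem_nth -?st.
  move: at_; rewrite all2E => /andP[_ /allP /(_ (nth (0,0) (zip t la) i))].
  by rewrite mem_nth ?size_zip ?st ?minnn -?st // nth_zip //=; apply.
rewrite size_filter -st.
have := count_predC (mem t) (iota 0 l); rewrite size_iota.
suff -> : count (mem t) (iota 0 l) = size t.
  by move=> /(congr1 (subn^~ (size t))); rewrite addKn.
rewrite -size_filter; apply/perm_size/uniq_perm => //.
  by rewrite filter_uniq ?iota_uniq.
by move=> x; rewrite mem_filter /=; case: (boolP (x \in t)) => // /sub ->.
Qed.

End rook_words.

Lemma card_RP_perm n (la : n.-tuple nat) :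
  #|RP la| = #|[set s : 'S_n | [forall i, (s i < tnth la (rev_ord i))%N]]%SET|.
Proof.
have inj : injective (@perm_mx bool n).
  move=> s s' /matrixP e; apply/permP => i; have := e i (s i).
  by rewrite !mxE eqxx; case: eqP.
rewrite -(card_imset _ inj); apply: eq_card => p.
rewrite inE; apply/andP/imsetP => [[/is_perm_mxP[s ->] /forallP h]|].
  exists s => //; rewrite inE; apply/forallP => i; rewrite ltnNge.
  have /forallP/(_ (s i)) := h i; rewrite ltnS !mxE eqxx.
  by case: leqP.
move=> [s]; rewrite inE => /forallP h ->; split; first exact: perm_mx_is_perm.
apply/forallP => i; apply/forallP => j; apply/implyP; rewrite !mxE.
by case: (s i =P j) => //= <-; rewrite ltnS leqNgt h.
Qed.

Lemma card_RP n (la : n.-tuple nat) :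
  sorted geq la -> (forall k, tnth la k <= n)%N ->
  #|RP la| = (\prod_(k < n) (tnth la k - (n - k.+1)))%N.
Proof.
move=> s_la le_n; rewrite card_RP_perm.
under eq_bigr => k _ do rewrite (tnth_nth 0%N).
have := size_rook_words s_la; rewrite size_tuple => <-.
set S := [set s | _]%SET.
(* Rows are read from last to first: row [i] is bounded by the part of index [rev_ord i], so letter
   [k] is bounded by part [k]. *)
pose word (s : 'S_n) := [seq val (s (rev_ord k)) | k <- enum 'I_n].
have nth_word (s : 'S_n) (k : 'I_n) : nth 0%N (word s) k = s (rev_ord k).
  by rewrite (nth_map k) ?size_enum_ord // nth_ord_enum.
have size_word s : size (word s) = n by rewrite size_map size_enum_ord.
have all2_ltn t : all2 ltn t la =
    (size t == n) && [forall k : 'I_n, (nth 0%N t k < tnth la k)%N].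
  rewrite all2E size_tuple; case: eqP => //= st; apply/allP/forallP.
    move=> h k; rewrite (tnth_nth 0%N).
    have := h (nth (0%N, 0%N) (zip t la) k).
    rewrite mem_nth ?size_zip ?st ?size_tuple ?minnn //.
    by rewrite nth_zip ?st ?size_tuple //; apply.
  move=> h z /(nthP (0%N, 0%N))[k].
  rewrite size_zip st size_tuple minnn => kn <-.
  rewrite nth_zip ?st ?size_tuple //=.
  by have := h (Ordinal kn); rewrite (tnth_nth 0%N).
rewrite cardE -(size_map word); apply/perm_size/uniq_perm.
- rewrite map_inj_uniq ?enum_uniq // => s s' ss'; apply/permP => i.
  by apply/ord_inj; rewrite -[i]rev_ordK -!nth_word ss'.
- exact: uniq_rook_words.
move=> t; rewrite mem_rook_words all2_ltn.
apply/mapP/idP => [[s]|/and3P[ut /eqP st /forallP lt_t]].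
  rewrite mem_enum inE => /forallP h ->; rewrite size_word eqxx /=.
  apply/andP; split.
    rewrite map_inj_uniq ?enum_uniq // => k k' /val_inj/perm_inj.
    exact: rev_ord_inj.
  by apply/forallP => k; rewrite nth_word -[k in tnth _ k]rev_ordK.
(* By [le_n] every letter is a column of the matrix; distinct letters then give an injective
   self-map of a finite set, hence a permutation. *)
have lt_n (i : 'I_n) : (nth 0%N t (rev_ord i) < n)%N.
  exact: leq_trans (lt_t _) (le_n _).
pose F i := Ordinal (lt_n i).
have F_inj : injective F.
  move=> i j Fij.
  have /eqP : nth 0%N t (rev_ord i) = nth 0%N t (rev_ord j).
    by have := congr1 (@nat_of_ord n) Fij.
  by rewrite nth_uniq ?st ?ltn_ord // => /eqP/ord_inj/rev_ord_inj.
exists (perm F_inj).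
  rewrite mem_enum inE; apply/forallP => i; rewrite permE.
  exact: lt_t (rev_ord i).
apply: (@eq_from_nth _ 0%N); first by rewrite size_word st.
move=> k; rewrite st => kn; rewrite (nth_word _ (Ordinal kn)) permE.
have -> : F (rev_ord (Ordinal kn)) =
    nth 0%N t (rev_ord (rev_ord (Ordinal kn))) :> nat by [].
by rewrite rev_ordK.
Qed.

Lemma ln_prod_nat (R : realType) (I : finType) (F : I -> nat) :
  (forall i, 0 < F i)%N ->
  ln ((\prod_i F i)%N%:R : R) = \sum_i ln ((F i)%:R).
Proof.
move=> F0; rewrite natr_prod.
(* Positivity of the partial products is carried along because [lnM] requires it. *)
apply: (big_ind2 (fun x y : R => 0 < x /\ ln x = y) _ _ _).2 => //.
- by rewrite ln1.
- by move=> x _ y _ [x0 <-] [y0 <-]; rewrite mulr_gt0 // lnM ?posrE.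
- by move=> i _; rewrite ltr0n F0.
Qed.

(** * The shape attached to [f] *)

Section lambda.
Context {R : realType} (f : R -> R) (hf : classP f).

Lemma lambda_point_itv (N : nat) (i : 'I_N) : 0 <= (i.+1%:R / N%:R : R) <= 1.
Proof.
have N0 : 0 < N%:R :> R by rewrite ltr0n (leq_trans _ (ltn_ord i)).
by rewrite divr_ge0 //= ler_pdivrMr // mul1r ler_nat ltn_ord.
Qed.

Lemma tnth_lambdaE (N : nat) (i : 'I_N) :
  Posz (tnth (lambda f N) i) = Num.ceil (N%:R * f (i.+1%:R / N%:R)).
Proof.
rewrite tnth_mktuple gez0_abs // ceil_ge0 (lt_le_trans (ltrN10 _)) //.
by have /andP[? _] := classP_range hf (lambda_point_itv i); rewrite mulr_ge0.
Qed.

Lemma lambda_le (N : nat) (i : 'I_N) : (tnth (lambda f N) i <= N)%N.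
Proof.
rewrite -lez_nat tnth_lambdaE ceil_le_int.
have /andP[_ f1] := classP_range hf (lambda_point_itv i).
by rewrite -[leRHS]/(N%:R) -[leRHS]mulr1 ler_wpM2l.
Qed.

Lemma lambda_sorted (N : nat) : sorted geq (lambda f N).
Proof.
apply/(sortedP 0%N) => k; rewrite size_tuple => kN.
have N0 : 0 < N%:R :> R by rewrite ltr0n (leq_trans _ kN).
rewrite -(tnth_nth 0%N _ (Ordinal kN)) -(tnth_nth 0%N _ (Ordinal (ltnW kN))).
rewrite /geq /= -lez_nat !tnth_lambdaE /= le_ceil // ler_wpM2l //.
have /andP[x0 _] := lambda_point_itv (Ordinal (ltnW kN)).
have /andP[_ y1] := lambda_point_itv (Ordinal kN).
apply: (classP_decreasing hf) => //.
by rewrite ler_wpM2r ?invr_ge0 // ler_nat.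
Qed.

End lambda.

(** * Stirling's formula *)

(** At [x = 1/n] the middle expression is [2/n] times the decrease, from [n] to [n + 1], of the
    error in Stirling's formula. *)
Lemma ln1Dx_cubic (R : realType) (x : R) : 0 <= x ->
  0 <= (2 + x) * ln (1 + x) - 2 * x <= x ^+ 3.
Proof.
move=> x0.
pose F : R -> R := (cst 1 + id) * @ln R - (cst 2 * id).
pose dF (u : R) := ln u + u^-1 - 1.
have F' (u : R) : 0 < u -> is_derive u 1 F (dF u).
  move=> u0; have ? := is_derive1_ln u0.
  apply: is_derive_eq.
  rewrite /GRing.scale /= /dF !fctE /=; field; lra.
(* The middle expression is [F (1 + x) - F 1], that is [dF c * x], and [dF c] lies between [0] and
   [(c - 1)^2 <= x^2]. *)
have [|||c] := @MVT_segment R F dF 1 (1 + x).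
- lra.
- by move=> u; rewrite in_itv /= => /andP[u1 _]; apply: F'; lra.
- apply: derivable_within_continuous => u; rewrite in_itv /= => /andP[u1 _].
  by have [] := F' u; first lra.
rewrite in_itv /= => /andP[c1 c2].
have -> : F (1 + x) - F 1 = (2 + x) * ln (1 + x) - 2 * x.
  rewrite /F !fctE ln1; ring.
move=> ->; have c0 : 0 < c by lra.
have h1 : 0 <= dF c.
  have : -1 < c^-1 - 1 by rewrite ltrBrDr addNr invr_gt0.
  by move/le_ln1Dx; rewrite subrKC lnV // /dF; lra.
have h2 : dF c <= x ^+ 2.
  have : ln c <= c - 1.
    by have := @le_ln1Dx R (c - 1); rewrite subrKC; apply; lra.
  have : c^-1 <= 1 - (c - 1) + (c - 1) ^+ 2.
    rewrite -div1r ler_pdivrMr //.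
    have -> : (1 - (c - 1) + (c - 1) ^+ 2) * c = 1 + (c - 1) ^+ 3 by ring.
    by rewrite lerDl exprn_ge0 // subr_ge0.
  rewrite /dF; nra.
rewrite addrC addKr mulr_ge0 //= exprSr; exact: ler_wpM2r.
Qed.

(** The error decreases by telescoping amounts from its initial value [1], hence stays between
    [1/(n + 1)] and [1]. *)
Lemma stirling_bound (R : realType) (n : nat) :
  `| ln (n.+1`!%:R : R) - n.+1%:R * ln n.+1%:R + n.+1%:R
     - 2^-1 * ln n.+1%:R | <= 2.
Proof.
pose u n : R := ln (n.+1`!%:R : R) - n.+1%:R * ln n.+1%:R + n.+1%:R
     - 2^-1 * ln n.+1%:R.
rewrite -/(u n).
have step k : 0 <= u k - u k.+1 <= k.+1%:R^-1 - k.+2%:R^-1.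
  have k0 : 0 < k.+1%:R :> R by rewrite ltr0n.
  have k1 : 1 <= k.+1%:R :> R by rewrite ler1n.
  have := @ln1Dx_cubic R k.+1%:R^-1; rewrite invr_ge0 ltW// => /(_ isT).
  have -> : 1 + k.+1%:R^-1 = k.+2%:R / k.+1%:R :> R.
    by rewrite -[k.+2%:R]natr1 mulrDl divff ?gt_eqF// div1r.
  rewrite ln_div ?posrE ?ltr0n //.
  rewrite /u (factS k.+1) natrM lnM ?posrE ?ltr0n ?fact_gt0 //.
  rewrite -(@natr1 _ k.+1).
  move: (ln _) (ln k.+1%:R) (ln _) => b c a.
  move: (k.+1%:R) k0 k1 => x x0 x1 /andP[h1 h2].
  have -> : b - x * c + x - 2^-1 * c -
    (a + b - (x + 1) * a + (x + 1) - 2^-1 * a) =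
    x * ((2 + x^-1) * (a - c) - 2 * x^-1) / 2.
    by field; lra.
  apply/andP; split; first by rewrite divr_ge0 // mulr_ge0 // ltW.
  (* The cubic bound gives [1/(2 x^2)], which is at most [1/(x (x + 1)) = 1/x - 1/(x + 1)] because
     [x >= 1]. *)
  apply: (@le_trans _ _ (x * x^-1 ^+ 3 / 2)).
    by rewrite ler_wpM2r // ler_wpM2l // ltW.
  have -> : x * x^-1 ^+ 3 / 2 = (x + 1) / (2 * x) * (1 / (x * (x + 1))).
    by field; lra.
  have -> : x^-1 - (x + 1)^-1 = 1 * (1 / (x * (x + 1))) by field; lra.
  rewrite ler_wpM2r //; first by rewrite divr_ge0 // mulr_ge0; lra.
  by rewrite ler_pdivrMr; lra.
have u0 : u 0%N = 1 by rewrite /u (_ : 1`! = 1%N) // ln1; lra.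
suff /andP[h1 h2] : n.+1%:R^-1 <= u n <= 1.
  by rewrite ger0_norm; [lra|rewrite (le_trans _ h1)].
elim: n => [|n /andP[IH1 IH2]]; first by rewrite u0 invr1 lexx.
have /andP[h1 h2] := step n; move: IH1 IH2 h1 h2.
move: (u n) (u n.+1) (n.+1%:R^-1) (n.+2%:R^-1) => a b c d h1 h2 h3 h4.
by apply/andP; split; lra.
Qed.

(** * Riemann sums of functions of bounded variation *)

Section bounded_variation.
Context {R : realType} (h w : R -> R).
(** Bounded variation is witnessed by a control function: the increments of [w] dominate those of
    [h]. *)
Hypothesis hw : forall x y, x <= y -> `|h y - h x| <= w y - w x.
Local Notation mu := (@lebesgue_measure R).

Lemma bounded_variation_measurable (D : set R) :
  measurable D -> measurable_fun D h.
Proof.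
move=> mD.
(* Jordan decomposition: both [h + w] and [w] are nondecreasing. *)
have -> : h = (h \+ w) \- w by apply/funext => x /=; rewrite addrK.
apply: measurable_funB; apply: nondecreasing_measurable => // x y xy /=.
  have := hw xy; rewrite ler_norml => /andP[+ _]; lra.
by rewrite -subr_ge0 (le_trans _ (hw xy)).
Qed.

Lemma bounded_variation_integrable (i : interval R) (a b : R) :
  [set` i] `<=` `[a, b] -> mu.-integrable [set` i] (EFin \o h).
Proof.
move=> iab; suff : mu.-integrable `[a, b] (EFin \o h) by apply: integrableS.
apply: measurable_bounded_integrable => //.
- by rewrite /= lebesgue_measure_itv /=; case: ifP => // _; rewrite -EFinB ltry.
- exact: bounded_variation_measurable.
exists (`|h a| + (w b - w a)); split; first by rewrite num_real.
move=> C hC x /=; rewrite in_itv /= => /andP[ax xb].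
have wxb : w x <= w b by rewrite -subr_ge0 (le_trans _ (hw xb)).
have := ler_normD (h x - h a) (h a); rewrite subrK => hx.
by have := hw ax; lra.
Qed.

Lemma Rintegral_itvoc_endpoint (a b : R) : a <= b ->
  `|(b - a) * h b - \int[mu]_(x in `]a, b]) h x| <= (b - a) * (w b - w a).
Proof.
move=> ab; have ih : mu.-integrable `]a, b] (EFin \o h).
  apply: (@bounded_variation_integrable _ a b) => x /=.
  exact: subset_itv_oc_cc.
have muab : fine (mu `]a, b]%classic) = b - a.
  rewrite lebesgue_measure_itv /= lte_fin.
  by case: ltgtP ab => //= <-; rewrite subrr.
have icst r : mu.-integrable `]a, b] (EFin \o cst r).
  apply: measurable_bounded_integrable => //; last exact: bounded_cst.
  by rewrite /= lebesgue_measure_itv /=; case: ifP => // _; rewrite -EFinB ltry.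
have bnd x : `]a, b]%classic x ->
    h b - (w b - w a) <= h x /\ h x <= h b + (w b - w a).
  rewrite /= in_itv /= => /andP[/ltW ax xb].
  have wax : w a <= w x by rewrite -subr_ge0 (le_trans _ (hw ax)).
  by have := hw xb; rewrite ler_norml => /andP[? ?]; split; lra.
have h1 : (h b - (w b - w a)) * (b - a) <= \int[mu]_(x in `]a, b]) h x.
  rewrite -muab -Rintegral_cst //; apply: le_Rintegral => //.
    exact: icst.
  by move=> x /bnd[].
have h2 : \int[mu]_(x in `]a, b]) h x <= (h b + (w b - w a)) * (b - a).
  rewrite -muab -Rintegral_cst //; apply: le_Rintegral => //.
    exact: icst.
  by move=> x /bnd[].
move: (Rintegral _ _ _) h1 h2 => I h1 h2; clear -h1 h2.
by rewrite ler_norml; apply/andP; split; lra.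
Qed.

(** On each cell the right-endpoint rule errs by at most [d] times the increment of [w], and these
    increments telescope. *)
Lemma Riemann_sum_bounded_variation (d : R) (n : nat) : 0 < d ->
  `|d * \sum_(k < n) h (k.+1%:R * d) - \int[mu]_(x in `[0, n%:R * d]) h x|
    <= d * (w (n%:R * d) - w 0).
Proof.
move=> d0; elim: n => [|n IH].
  rewrite big_ord0 mul0r set_itv1 Rintegral_set1 subrr !mulr0 subr0.
  by rewrite normr0.
have nd : n.+1%:R * d = n%:R * d + d by rewrite -natr1 mulrDl mul1r.
have nd0 : 0 <= n%:R * d by rewrite mulr_ge0 // ltW.
have IB : \int[mu]_(t in `[0, n.+1%:R * d]) h t
    - \int[mu]_(t in `[0, n%:R * d]) h t
    = \int[mu]_(t in `]n%:R * d, n.+1%:R * d]) h t.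
  apply: Rintegral_itvB; rewrite ?bnd_simp //; last by rewrite nd lerDl ltW.
  exact: (@bounded_variation_integrable _ 0 (n.+1%:R * d)).
have := @Rintegral_itvoc_endpoint (n%:R * d) (n.+1%:R * d).
rewrite -IB big_ord_recr /= nd lerDl (ltW d0) => /(_ isT).
rewrite addrAC subrr add0r mulrDr.
move: (\int[mu]_(t in `[0, n%:R * d + d]) h t)
  (\int[mu]_(t in `[0, n%:R * d]) h t) IH => I1 I0 IH.
rewrite !ler_norml => /andP[h1 h2]; move: IH; rewrite ler_norml => /andP[h3 h4].
clear -h1 h2 h3 h4.
by apply/andP; split; lra.
Qed.

End bounded_variation.

(** * The integral of the logarithm *)

(** For [b <= a], [ln (a / b) <= a / b - 1 = (a - b) / b], and [b >= c]. *)
Lemma ln_dist_le (R : realType) (c a b : R) : 0 < c -> c <= a -> c <= b ->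
  `|ln a - ln b| <= c^-1 * `|a - b|.
Proof.
move=> c0; wlog ab : a b / b <= a => [H ca cb|ca cb].
  by have [/H|/ltW/H] := leP b a; [exact|rewrite distrC [`|a - b|]distrC; exact].
have a0 : 0 < a by exact: lt_le_trans ca.
have b0 : 0 < b by exact: lt_le_trans cb.
rewrite !ger0_norm ?subr_ge0 ?ler_ln ?posrE //.
rewrite -ln_div ?posrE //.
have := @le_ln1Dx R (a / b - 1); rewrite subrKC => /(_ _) h.
apply: le_trans (h _) _.
  by rewrite ltrBrDr addNr divr_gt0.
rewrite -[X in _ - X](divff (lt0r_neq0 b0)) -mulrBl mulrC ler_wpM2r ?subr_ge0 //.
by rewrite lef_pV2 ?posrE.
Qed.

Lemma cvg_xlnx0 (R : realType) : x * ln x @[x --> (0 : R)^'+] --> 0.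
Proof.
apply: (@squeeze_cvgr _ _ _ _ (fun x => - (2 * Num.sqrt x)) (fun=> 0)).
- near=> x.
  have x0 : 0 < x by [].
  have x1 : x <= 1 by near: x; apply: nbhs_right_ltW.
  have s0 : 0 < Num.sqrt x by rewrite sqrtr_gt0.
  have xs : x = Num.sqrt x ^+ 2 by rewrite sqr_sqrtr // ltW.
  apply/andP; split; last by rewrite pmulr_rle0 // ln_le0.
  (* Applied to [1 / sqrt x], this bounds [- ln (sqrt x)] by [1 / sqrt x]; as
     [ln x = 2 ln (sqrt x)], it yields [x ln x >= - 2 sqrt x]. *)
  have := ln_sublinear (x := (Num.sqrt x)^-1); rewrite invr_gt0 => /(_ s0).
  rewrite lnV ?posrE // => h.
  have -> : x * ln x = Num.sqrt x ^+ 2 * (ln (Num.sqrt x) *+ 2).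
    by rewrite -lnXn // -xs.
  rewrite mulr2n.
  have : Num.sqrt x ^+ 2 * (Num.sqrt x)^-1 = Num.sqrt x by field; lra.
  have : 0 < Num.sqrt x ^+ 2 by rewrite exprn_gt0.
  move: (ln _) (_^-1) (Num.sqrt x ^+ 2) h => l v s h s20 sv.
  nra.
- rewrite -[X in _ --> X]oppr0 -[X in _ --> - X](mulr0 2) -[X in 2 * X](sqrtr0 R).
  apply: cvgN; apply: cvgMr; apply: cvg_at_right_filter; exact: sqrt_continuous.
- exact: cvg_cst.
Unshelve. all: by end_near. Qed.

Lemma Rintegral_ln (R : realType) (a b : R) : 0 < a -> a < b ->
  \int[@lebesgue_measure R]_(x in `[a, b]) ln x
    = (b * ln b - b) - (a * ln a - a).
Proof.
move=> a0 ab; pose F : R -> R := id * @ln R - id.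
have F' (u : R) : 0 < u -> is_derive u 1 F (ln u).
  move=> u0; have ? := is_derive1_ln u0.
  apply: is_derive_eq.
  by rewrite /GRing.scale /=; field; lra.
have Fc (u : R) : 0 < u -> F x @[x --> u] --> F u.
  move=> u0; apply: differentiable_continuous; apply/derivable1_diffP.
  by have [] := F' u u0.
rewrite /Rintegral (@continuous_FTC2 R _ F) //.
- apply: continuous_in_subspaceT => u; rewrite inE /= in_itv /= => /andP[au _].
  by apply: continuous_ln; lra.
- split.
  + by move=> u; rewrite in_itv /= => /andP[au _]; have [] := F' u; first lra.
  + exact/cvg_at_right_filter/Fc.
  + by apply/cvg_at_left_filter/Fc; lra.
- move=> u; rewrite in_itv /= => /andP[au _].
  by rewrite derive1E; have [_ ->] := F' u (lt_trans a0 au).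
Qed.

(** * The logarithmic profile of a function of class P *)

(* [x + f x - 1] need not be continuous: monotonicity controls it to the left of
   each point, and the right limit controls it to the right. *)
Lemma classP_lower_bound (R : realType) (f : R -> R) (d : R) :
  classP f -> 0 < d ->
  exists2 c : R, 0 < c & forall x, d <= x <= 1 -> c <= f x + x - 1.
Proof.
move=> hf d0.
(* By compactness of [[d, 1]], it suffices to find near each point a positive lower bound valid on a
   neighbourhood. *)
have /compact_near_coveringP/(_ R (0 : R)^'+) := @segment_compact R d 1.
move=> /(_ (fun c x => d <= x <= 1 -> c <= f x + x - 1) _) H.
suff /H Hc : forall x, `[d, 1]%classic x ->
    \forall x' \near x & c \near 0^'+, d <= x' <= 1 -> c <= f x' + x' - 1.
  have [c [c0 cP]] : exists c, 0 < c /\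
      `[d, 1]%classic `<=` (fun x => d <= x <= 1 -> c <= f x + x - 1).
    apply: (@filter_ex _ (0 : R)^'+); near=> c; split=> //.
    by near: c.
  exists c => // x xd1; apply: cP => //.
move=> a; rewrite /= in_itv /= => /andP[da a1].
have a0 : 0 < a by lra.
have [g g0 [r r0 gP]] : exists2 g, 0 < g & exists2 r, 0 < r &
    forall x, 0 <= x -> a - r < x < a + r -> x <= 1 -> g < f x + x - 1.
  (* At [a = 1] the right-limit condition says nothing; [f 1 > 0] and monotonicity take its
     place. *)
  move: a1; rewrite le_eqVlt => /predU1P[a1|a1].
    have f1 := classP_at1 hf.
    exists (f 1 / 2); first by lra.
    exists (f 1 / 2); first by lra.
    move=> x x0 /andP[xl _] x1.
    by have := classP_decreasing hf x0 x1 (lexx 1); lra.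
  have [|l fl al] := @classP_right_limit _ _ hf a; first by rewrite a0.
  (* A quarter of the gap leaves room for two losses of [g]: one from approximating [l] by [f], one
     from moving left of [a] by less than [g]. *)
  have [g g0 g4] : exists2 g, 0 < g & l - 1 + a = 4 * g.
    by exists ((l - (1 - a)) / 4); [lra|field].
  have [r /= r0 rP] : \forall x \near a^'+, `|l - f x| < g.
    by move/cvgrPdist_lt: fl; apply.
  have fR x : a < x < a + r -> l - g < f x.
    move=> /andP[ax xr]; have /rP/(_ ax) : ball_ [eta Num.Def.normr] a r x.
      by rewrite /= ltr0_norm; lra.
    by rewrite ltr_norml => /andP[_]; lra.
  have fL : l - g < f a.
    have [m0 [m1 m2]] : 0 < Num.min r (1 - a) /\ Num.min r (1 - a) <= r /\
        Num.min r (1 - a) <= 1 - a.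
      by rewrite lt_min !ge_min !lexx orbT r0 subr_gt0 a1.
    move: (Num.min _ _) m0 m1 m2 => m m0 m1 m2.
    have : l - g < f (a + m / 2) by apply: fR; apply/andP; split; lra.
    have : f (a + m / 2) <= f a by apply: (classP_decreasing hf); lra.
    by move=> /[swap]; exact: lt_le_trans.
  have [m0 [m1 m2]] : 0 < Num.min r g /\ Num.min r g <= r /\ Num.min r g <= g.
    by rewrite lt_min !ge_min !lexx orbT r0 g0.
  exists g => //; exists (Num.min r g) => //.
  move: (Num.min r g) m1 m2 {m0} => m m1 m2 x x0 /andP[xl xr] x1.
  case: (leP x a) => xa.
    have := classP_decreasing hf x0 xa (ltW a1).
    by lra.
  have := fR x; rewrite xa /=.
  have -> : x < a + r by lra.
  by move=> /(_ isT); lra.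
exists ([set x | a - r < x < a + r], [set c | c <= g]).
  split; last exact: nbhs_right_ltW.
  by exists r => //= x /=; rewrite ltr_distlC.
move=> [x c] /= [xr cg] /andP[dx x1].
by apply/ltW/(le_lt_trans cg)/gP => //; lra.
Unshelve. all: by end_near. Qed.

Definition clamp (R : realType) (d x : R) : R := Num.min (Num.max x d) 1.

(* Subtracting [ln x] from [ln (f x + x - 1)] removes the singularity at [0],
   where [f x + x - 1 = x]; [clamp] then extends the difference to a function of
   bounded variation on the whole line. *)
Definition log_ratio (R : realType) (f : R -> R) (d x : R) : R :=
  ln (f (clamp d x) + clamp d x - 1) - ln (clamp d x).

(** Control function for [log_ratio]: [x - f x] increases and dominates the changes of
    [f x + x - 1], while [c^-1] and [d^-1] are Lipschitz constants of [ln] above [c] and above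
    [d]. *)
Definition log_ratio_var (R : realType) (f : R -> R) (c d x : R) : R :=
  c^-1 * (clamp d x - f (clamp d x)) + d^-1 * clamp d x.

Section class_P.
Context {R : realType} (f : R -> R) (c d : R).
Hypothesis hf : classP f.
Hypotheses (c0 : 0 < c) (d0 : 0 < d) (d1 : d <= 1).
Hypothesis f_near0 : forall x, 0 <= x <= d -> f x = 1.
Hypothesis c_lower : forall x, d <= x <= 1 -> c <= f x + x - 1.
Local Notation mu := (@lebesgue_measure R).

Lemma clamp_itv x : d <= clamp d x <= 1.
Proof. by rewrite /clamp le_min le_max lexx orbT d1 ge_min lexx orbT. Qed.

Lemma le_clamp x y : x <= y -> clamp d x <= clamp d y.
Proof.
move=> xy; rewrite /clamp le_min !ge_min lexx orbT andbT.
by rewrite ge_max !le_max xy lexx !orbT.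
Qed.

Lemma clamp_id x : d <= x <= 1 -> clamp d x = x.
Proof. by move=> /andP[dx x1]; rewrite /clamp max_l // min_l. Qed.

Lemma clamp_le x : x <= d -> clamp d x = d.
Proof. by move=> xd; rewrite /clamp max_r // min_l. Qed.

Lemma log_ratio_near0 x : x <= d -> log_ratio f d x = 0.
Proof.
move=> xd; rewrite /log_ratio clamp_le // f_near0 ?lexx ?ltW //.
by rewrite addrAC subrr add0r subrr.
Qed.

Lemma log_ratio_variation x y : x <= y ->
  `|log_ratio f d y - log_ratio f d x|
    <= log_ratio_var f c d y - log_ratio_var f c d x.
Proof.
move=> /le_clamp; rewrite /log_ratio /log_ratio_var.
have := clamp_itv x; have := clamp_itv y; move: (clamp d x) (clamp d y) => u v.
move=> dv du uv; have /andP[du1 u1] := du; have /andP[dv1 v1] := dv.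
have fvu : f v <= f u.
  by apply: (classP_decreasing hf) => //; exact: le_trans (ltW d0) du1.
have h1 : `|ln (f v + v - 1) - ln (f u + u - 1)| <= c^-1 * (f u - f v + (v - u)).
  apply: le_trans (ln_dist_le c0 (c_lower dv) (c_lower du)) _.
  rewrite ler_wpM2l ?invr_ge0 ?(ltW c0) // ler_norml.
  by apply/andP; split; lra.
have h2 : `|ln v - ln u| <= d^-1 * (v - u).
  apply: le_trans (ln_dist_le d0 dv1 du1) _.
  by rewrite ger0_norm ?subr_ge0.
move: h1 h2; rewrite !ler_norml; move: (ln _) (ln _) (ln _) (ln _) => p q r s.
move=> /andP[h1 h2] /andP[h3 h4]; apply/andP; split; lra.
Qed.

Lemma ln_profileE x : 0 < x <= 1 ->
  ln (f x + x - 1) = log_ratio f d x + ln x.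
Proof.
move=> /andP[x0 x1]; have [dx|xd] := leP d x.
  by rewrite /log_ratio clamp_id ?dx // subrK.
rewrite log_ratio_near0 ?ltW // add0r f_near0 ?(ltW x0) ?(ltW xd) //.
by rewrite addrAC subrr add0r.
Qed.

(** For [e < d], truncating at [e] leaves the integral of [log_ratio] unchanged, since it vanishes
    on [[0, d]]. Only the integral of [ln] varies, and it tends to [-1]. *)
Lemma BconstE : Bconst f = \int[mu]_(x in `[0, 1]) log_ratio f d x - 1.
Proof.
have iP (i : interval R) : [set` i] `<=` `[0, 1] ->
    mu.-integrable [set` i] (EFin \o log_ratio f d).
  exact: bounded_variation_integrable log_ratio_variation _ _ _.
set I := Rintegral _ _ _; apply: cvg_lim; first exact: Rhausdorff.
have : I - 1 - (e * ln e - e) @[e --> 0^'+] --> I - 1 - (0 - 0).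
  apply: cvgB; first exact: cvg_cst.
  by apply: cvgB; [exact: cvg_xlnx0|exact: cvg_at_right_filter].
rewrite !subr0; apply: cvg_trans; apply: near_eq_cvg; near=> e.
have e0 : 0 < e by [].
have ed : e < d by near: e; exact: nbhs_right_lt.
have e1 : e < 1 by exact: lt_le_trans d1.
have sub : `[e, 1]%classic `<=` `[0, 1]%classic.
  by apply: subset_itvr; rewrite bnd_simp ltW.
rewrite (@eq_Rintegral _ _ _ mu _ (fun x => log_ratio f d x + ln x)); last first.
  move=> x; rewrite inE /= in_itv /= => /andP[ex x1]; rewrite ln_profileE //.
  by rewrite x1 (lt_le_trans e0).
rewrite RintegralD //; last 2 first.
- exact: iP.
- apply: continuous_compact_integrable; first exact: segment_compact.
  apply: continuous_in_subspaceT => u; rewrite inE /= in_itv /= => /andP[eu _].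
  by apply: continuous_ln; exact: lt_le_trans eu.
rewrite Rintegral_ln // ln1 mulr0 sub0r.
suff -> : \int[mu]_(x in `[e, 1]) log_ratio f d x = I by rewrite addrA.
have := @Rintegral_itvB R (log_ratio f d) (BLeft 0) (BRight 1) e.
rewrite (@eq_Rintegral _ _ _ mu `[0, e] (cst 0)); last first.
  move=> x; rewrite inE /= in_itv /= => /andP[_ xe].
  by rewrite log_ratio_near0 // (le_trans xe) // ltW.
rewrite Rintegral_cst // mul0r subr0 -/I => ->.
- rewrite Rintegral_itv_obnd_cbnd //; apply: iP.
  by apply: subset_trans sub; exact: subset_itv_oc_cc.
- exact: iP.
- by rewrite bnd_simp ltW.
- by rewrite bnd_simp ltW.
Unshelve. all: by end_near. Qed.

(** The ceiling moves [N (f x + x - 1)] up by less than [1]; this quantity is at least [c N] when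
    [x >= d], so its logarithm moves by at most [1/(c N)]. *)
Lemma lambda_factor (N : nat) (i : 'I_N) :
  (0 < tnth (lambda f N) i - (N - i.+1))%N /\
  0 <= ln ((tnth (lambda f N) i - (N - i.+1))%:R : R)
       - ln i.+1%:R - log_ratio f d (i.+1%:R / N%:R) <= (c * N%:R)^-1.
Proof.
rewrite tnth_mktuple; have i1 := ltn_ord i.
have N0 : 0 < N%:R :> R by rewrite ltr0n (leq_trans _ i1).
have k0 : 0 < i.+1%:R :> R by rewrite ltr0n.
have kN : i.+1%:R <= N%:R :> R by rewrite ler_nat.
set k := i.+1 in k0 kN *; set x := _ / _.
have Nx : N%:R * x = k%:R by rewrite /x; field; lra.
have x0 : 0 < x by rewrite divr_gt0.
have x1 : x <= 1 by rewrite ler_pdivrMr // mul1r.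
set z := Num.ceil _.
have f0 : 0 <= f x <= 1 by apply: (classP_range hf); rewrite x1 ltW.
have /andP[zl zu] := ceil_itv (N%:R * f x); rewrite -/z in zl zu.
have gx : 0 < N%:R * f x + k%:R - N%:R.
  rewrite -Nx -mulrDr -[X in _ - X]mulr1 -mulrBr pmulr_rgt0 //.
  have [dx|xd] := leP d x; first by rewrite (lt_le_trans c0) // c_lower ?dx.
  by rewrite f_near0 ?(ltW x0) ?(ltW xd) // addrAC subrr add0r.
have zE : `|z|%N%:R = z%:~R :> R.
  rewrite natr_absz ger0_norm // ceil_ge0 (lt_le_trans (ltrN10 _)) //.
  by rewrite mulr_ge0 //; case/andP: f0.
(* The subtraction is not truncated: [z >= N f x], so [z + k - N] is positive by [gx]. *)
have pE : (`|z|%N - (N - k))%:R = z%:~R + k%:R - N%:R :> R.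
  rewrite natrB ?natrB ?zE //; first by ring.
  by rewrite -(ler_nat R) natrB // zE; lra.
split; first by rewrite -(ltr_nat R) pE; lra.
rewrite pE; have [dx|xd] := leP d x; last first.
  (* Left of [d] the ceiling is [N] itself, so the factor is exactly [k] and the error is [0]. *)
  have -> : z = N%:Z.
    rewrite /z f_near0 ?(ltW x0) ?(ltW xd) // mulr1.
    exact: (intrKceil N%:Z).
  rewrite log_ratio_near0 ?(ltW xd) // subr0 -pmulrn addrAC subrr add0r.
  by rewrite subrr lexx invr_ge0 mulr_ge0 // ltW.
rewrite /log_ratio clamp_id ?dx // {2}/x ln_div ?posrE //.
have cg : c <= f x + x - 1 by rewrite c_lower ?dx.
have g0 : 0 < f x + x - 1 by exact: lt_le_trans cg.
have NgE : N%:R * (f x + x - 1) = N%:R * f x + k%:R - N%:R.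
  by rewrite -Nx; ring.
have -> : forall p : R, ln p - ln k%:R - (ln (f x + x - 1) - (ln k%:R - ln N%:R))
    = ln p - ln (N%:R * (f x + x - 1)).
  by move=> p; rewrite lnM ?posrE //; ring.
have le1 : N%:R * (f x + x - 1) <= z%:~R + k%:R - N%:R.
  by rewrite NgE; lra.
have cN : c * N%:R <= N%:R * (f x + x - 1) by rewrite mulrC ler_wpM2l // ltW.
apply/andP; split.
  have Ng0 : 0 < N%:R * (f x + x - 1) by rewrite mulr_gt0.
  by rewrite subr_ge0 ler_ln ?posrE // (lt_le_trans Ng0).
apply: le_trans (ler_norm _) _.
have cN0 : 0 < c * N%:R by rewrite mulr_gt0.
apply: le_trans (ln_dist_le cN0 (le_trans cN le1) cN) _.
rewrite -[leRHS]mulr1 ler_wpM2l ?invr_ge0 ?(ltW cN0) // ger0_norm ?subr_ge0 //.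
by rewrite NgE; move: zl; rewrite intrB; lra.
Qed.

End class_P.

(** * Combining the product formula, Stirling's formula and the Riemann sum *)

Theorem theorem3p7 (R : realType) (f : R -> R) (hf : classP f)
    (m : nat) (rho : nat -> R)
    (rho_first : rho 0%N = 0) (rho_last : rho m.+1 = 1)
    (rho_incr : forall i, (i <= m)%N -> rho i < rho i.+1)
    (rho_nondiff : [set rho i | i in [set i | (1 <= i <= m)%N]]
                   = nondiff_points f) :
  exists2 C : R, 0 < C &
    forall N : nat, (0 < N)%N ->
      (forall i, (i <= m.+1)%N -> exists z : int, N%:R * rho i = z%:~R) ->
      `| ln (#|RP (lambda f N)|%:R) - N%:R * ln N%:R - Bconst f * N%:R
         - 2^-1 * ln N%:R | <= C.
Proof.
have [e e0 fe] := classP_near0 hf.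
(* Strictness [d < e] gives [f = 1] on the closed interval [[0, d]]. *)
have [d [d0 d1 de]] : exists d : R, [/\ 0 < d, d <= 1 & d < e].
  exists (Num.min e 1 / 2).
  have [m0 [m1 m2]] : 0 < Num.min e 1 /\ Num.min e 1 <= e /\ Num.min e 1 <= 1.
    by rewrite lt_min !ge_min !lexx orbT e0 ltr01.
  by split; lra.
have f_near0 x : 0 <= x <= d -> f x = 1.
  by move=> /andP[x0 xd]; apply: fe; rewrite x0 (le_lt_trans xd).
have [c c0 c_lower] := classP_lower_bound hf d0.
pose h := log_ratio f d; pose w := log_ratio_var f c d.
have hw : forall x y, x <= y -> `|h y - h x| <= w y - w x.
  exact: log_ratio_variation.
have w01 : 0 <= w 1 - w 0 by exact: le_trans (hw 0 1 ler01).
have cV : 0 < c^-1 by rewrite invr_gt0.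
(* The three terms bound the errors from Stirling's formula, from the Riemann sum and from the
   ceilings. *)
exists (2 + (w 1 - w 0) + c^-1); first by lra.
move=> N N0 _; have NR : 0 < N%:R :> R by rewrite ltr0n.
have hlam i := lambda_factor hf c0 d0 d1 f_near0 c_lower (N := N) i.
rewrite (BconstE hf c0 d0 d1 f_near0 c_lower) -/h.
rewrite (card_RP (lambda_sorted hf N) (lambda_le hf (N := N))).
rewrite ln_prod_nat; last by move=> i; exact: (hlam i).1.
have stir := stirling_bound R N.-1; rewrite prednK // in stir.
have riem := Riemann_sum_bounded_variation hw N (d := N%:R^-1).
rewrite invr_gt0 divff ?gt_eqF // in riem; have {}riem := riem NR.
have factE : ln (N`!%:R : R) = \sum_(i < N) ln i.+1%:R.
  by rewrite fact_prod big_add1 big_mkord ln_prod_nat.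
set S := \sum_(i < N) ln _.
set H := \sum_(k < N) h _ in riem.
set I := Rintegral _ _ _ in riem *.
(* The [N] ceiling errors, each at most [1/(c N)], add up to at most [c^-1]. *)
have hS : 0 <= S - ln (N`!%:R : R) - H <= c^-1.
  have -> : S - ln (N`!%:R : R) - H = \sum_(i < N)
      (ln ((tnth (lambda f N) i - (N - i.+1))%:R : R) - ln i.+1%:R
        - log_ratio f d (i.+1%:R / N%:R)).
    by rewrite factE 2!sumrB.
  apply/andP; split; first by apply: sumr_ge0 => i _; case/andP: (hlam i).2.
  have -> : c^-1 = \sum_(i < N) (c * N%:R)^-1.
    by rewrite sumr_const card_ord -mulr_natl; field; lra.
  by apply: ler_sum => i _; case/andP: (hlam i).2.
have hH : `|H - N%:R * I| <= w 1 - w 0.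
  have -> : H - N%:R * I = N%:R * (N%:R^-1 * H - I) by field; lra.
  rewrite normrM gtr0_norm // -ler_pdivlMl //.
(* The quantity to bound is the sum of [S - ln N! - H], [H - N I] and the Stirling error; the [-1]
   in [BconstE] supplies the [+ N] of the latter. *)
move: hS hH stir; rewrite !ler_norml.
move: S H I (ln N`!%:R) (ln N%:R) {riem factE} => S H I F L.
move=> /andP[a1 a2] /andP[b1 b2] /andP[s1 s2].
clear -a1 a2 b1 b2 s1 s2; apply/andP; split; lra.
Qed.
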